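(* Let $n>1$ be an integer, $\mathbb{F}=\{1,-1\}$, and let $m$ be the positive integer with $n=2m$ or $n=2m+1$. Let $A\in M_n(\mathbb{F})$ be the matrix whose $(i,j)$-th element, for $i,j\in\{0,1,\ldots,n-1\}$, is $$A_{i,j}=\begin{cases}1, & \text{if } n=2m \text{ and } ij\equiv t \pmod n \text{ for some } t\in\{0,1,\ldots,m-1\},\\ 1, & \text{if } n=2m+1 \text{ and } ij\equiv t' \pmod n \text{ for some } t'\in\{0,1,\ldots,m\},\\ -1, & \text{otherwise}.\end{cases}$$ Then $A$ is sequency-complete.
   Context: $M_n(\mathbb{F})$ is the set of $n\times n$ matrices with entries in $\mathbb{F}=\{1,-1\}$; rows and columns are indexed $0,1,\ldots,n-1$. The sequency of $v=[v_0\ v_1\ \cdots\ v_{n-1}]^T\in\mathbb{F}^n$ is $\mathcal{S}_v=\frac12\sum_{k=0}^{n-2}|v_k-v_{k+1}|$ (the number of sign changes). For $A\in M_n(\mathbb{F})$, $\mathcal{S}_j$ denotes the sequency of its $j$-th column, and $A$ is sequency-complete if $j\mapsto\mathcal{S}_j$ is a bijection of $\{0,1,\ldots,n-1\}$ onto itself (each value $0,\ldots,n-1$ occurs as the sequency of exactly one column). *)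

(* Defs.v *)
From HB Require Import structures.
From mathcomp Require Import all_boot all_order all_algebra.

Set Implicit Arguments.
Unset Strict Implicit.
Unset Printing Implicit Defensive.

Import Order.TTheory GRing.Theory Num.Theory.

Local Open Scope ring_scope.

Definition sign : Type := {x : rat | x \in pred2 1 (-1)}.

(* For k < n - 1, the consecutive indices k (idx_lo) and k + 1 (idx_hi) *)
Definition idx_lo (n : nat) (k : 'I_n.-1) : 'I_n := widen_ord (leq_pred n) k.

Definition idx_hi (n : nat) (k : 'I_n.-1) : 'I_n :=
  Ordinal (etrans (esym (ltn_predRL k n)) (ltn_ord k)).

Definition sequency (n : nat) (v : 'cV[sign]_n) : rat :=
  2^-1 * \sum_(k < n.-1) `|val (v (idx_lo k) ord0) - val (v (idx_hi k) ord0)|.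

(* The sequency is a rational by definition, so that j |-> sequency (col j A)
   being a bijection of {0, ..., n - 1} says that it is given by some bijective
   f : 'I_n -> 'I_n. *)
Definition sequency_complete (n : nat) (A : 'M[sign]_n) : Prop :=
  exists2 f : 'I_n -> 'I_n,
    bijective f & forall j : 'I_n, sequency (col j A) = (f j)%:R.

(* Main.v *)
Require Import Defs.
From HB Require Import structures.
From mathcomp Require Import all_boot all_order all_algebra.
From mathcomp Require Import zify.

(** The matrix samples a square wave: the residue [a] mod [n] lies in the lower
    half of [0, n) exactly when [2 * a %/ n] is even, whatever the parity of
    [n], so [A i j = (-1) ^+ (2 * (i * j) %/ n)] ([wave_sign]).  The sequency of
    column [j] thus counts the parity changes of [q i = 2 * (i * j) %/ n] for
    [i = 0, ..., n - 1].

    If [2 * j <= n], each step raises [q] by 0 or 1, and a parity change is a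
    raise by 1: the count is [q (n - 1)].  If [n <= 2 * j], each step raises [q]
    by 1 or 2, and a parity change is a raise that falls short of 2: the count is
    [2 * (n - 1) - q (n - 1)].  Since [q (n - 1) = 2 * j - ceil (2 * j / n)], the
    sequencies are 0 for [j = 0], the odd numbers [2 * j - 1] for
    [0 < j <= n / 2], and the positive even numbers [2 * (n - j)] for
    [n / 2 < j < n].  These are pairwise distinct and less than [n]. *)

Set Implicit Arguments.
Unset Strict Implicit.
Unset Printing Implicit Defensive.

Import Order.TTheory GRing.Theory Num.Theory.

Local Open Scope ring_scope.

Lemma exists_ord_eqmod (n p a : nat) : (p <= n)%N ->
  [exists t : 'I_p, a == t %[mod n]] = (a %% n < p)%N.
Proof.
move=> le_pn; apply/existsP/idP => [[t /eqP ->]|lt_ap].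
  by rewrite modn_small // (leq_trans (ltn_ord t)).
by exists (Ordinal lt_ap); rewrite /= modn_mod.
Qed.

Lemma odd_div_double (n a : nat) : (0 < n)%N ->
  odd (2 * a %/ n) = (n <= 2 * (a %% n))%N.
Proof.
move=> n_gt0; have lt_r := ltn_pmod a n_gt0.
rewrite {1}(divn_eq a n) mulnDr mulnA divnMDl // oddD oddM /=.
case: leqP => [le_n|lt_n]; last by rewrite divn_small.
(* the quotient is 1, since [n <= 2 * (a %% n) < 2 * n] *)
rewrite -(subnKC le_n) -{1}[n]mul1n divnMDl // divn_small //.
lia.
Qed.

(** Both parities of [n] give the same formula, because the number of residues
    carrying the value 1 is in each case [uphalf n]. *)
Lemma wave_sign (n m a : nat) : (0 < m)%N ->
    n = (2 * m)%N \/ n = (2 * m + 1)%N ->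
  (if (n == 2 * m)%N && [exists t : 'I_m, a == t %[mod n]] then 1
   else if (n == 2 * m + 1)%N && [exists t : 'I_m.+1, a == t %[mod n]] then 1
   else -1) = (-1) ^+ (2 * a %/ n) :> rat.
Proof.
move=> m_gt0 hnm; have n_gt0 : (0 < n)%N by lia.
rewrite -signr_odd odd_div_double // !exists_ord_eqmod; [|lia|lia].
move: (a %% n)%N => r.
case: (leqP n (2 * r)) => h; rewrite ?expr1 ?expr0.
  by rewrite !ifF //; lia.
case: hnm => hn; first by rewrite ifT //; lia.
by case: ifP => // _; rewrite ifT //; lia.
Qed.

Lemma half_dist_sign (a b : nat) :
  2^-1 * `|(-1) ^+ a - (-1) ^+ b| = (odd a (+) odd b)%:R :> rat.
Proof. by rewrite -signr_odd -[X in _ - X]signr_odd; case: odd; case: odd. Qed.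

Lemma sequency_of_exponents (n : nat) (v : 'cV[sign]_n) (q : nat -> nat) :
    (forall i, val (v i ord0) = (-1) ^+ q i) ->
  sequency v = (\sum_(k < n.-1) (odd (q k) (+) odd (q k.+1)))%:R.
Proof.
move=> hv; rewrite /sequency mulr_sumr natr_sum.
by apply: eq_bigr => k _; rewrite !hv half_dist_sign.
Qed.

(** A step of 0 or 1 changes parity exactly when it is 1, so the count of
    changes telescopes. *)
Lemma parity_changes_slow (q : nat -> nat) (N : nat) :
    q 0%N = 0%N -> (forall k, q k <= q k.+1 <= q k + 1)%N ->
  (\sum_(k < N) (odd (q k) (+) odd (q k.+1)) = q N)%N.
Proof.
move=> q0 hq; elim: N => [|N IH]; first by rewrite big_ord0.
by rewrite big_ord_recr /= IH; have := hq N; lia.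
Qed.

(** Replacing [q k] by [2 * k - q k] keeps the parities and turns steps of
    1 or 2 into steps of 1 or 0. *)
Lemma parity_changes_fast (q : nat -> nat) (N : nat) :
    q 0%N = 0%N -> (forall k, q k + 1 <= q k.+1 <= q k + 2)%N ->
  (\sum_(k < N) (odd (q k) (+) odd (q k.+1)) = 2 * N - q N)%N.
Proof.
move=> q0 hq.
have q_le k : (q k <= 2 * k)%N.
  by elim: k => [|k IH]; [rewrite q0 | have := hq k; lia].
rewrite -(@parity_changes_slow (fun k => 2 * k - q k)%N) ?q0 // => [|k].
  by apply: eq_bigr => k _; rewrite !oddB // !oddM.
by have := hq k; have := q_le k; lia.
Qed.

Lemma divn_step (n a b c : nat) : (0 < n)%N -> (c * n <= b <= c.+1 * n)%N ->
  (a %/ n + c <= (a + b) %/ n <= a %/ n + c.+1)%N.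
Proof.
move=> n_gt0 /andP[le_cb le_bc].
have shift d : (a %/ n + d = (a + d * n) %/ n)%N.
  by rewrite addnC -divnMDl // addnC.
by rewrite !shift !leq_div2r ?leq_add2l.
Qed.

Definition column_sequency (n j : nat) : nat :=
  if (2 * j <= n)%N then (2 * j).-1 else (2 * (n - j))%N.

Lemma column_sequency_lt (n j : nat) : (0 < n)%N -> (j < n)%N ->
  (column_sequency n j < n)%N.
Proof. by rewrite /column_sequency; case: ifP; lia. Qed.

Lemma column_sequency_inj (n i j : nat) : (i < n)%N -> (j < n)%N ->
  column_sequency n i = column_sequency n j -> i = j.
Proof. by rewrite /column_sequency; do 2![case: ifP]; lia. Qed.

Lemma wave_parity_changes (n j : nat) : (1 < n)%N -> (j < n)%N ->
  (\sum_(k < n.-1)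
     (odd (2 * (k * j) %/ n) (+) odd (2 * (k.+1 * j) %/ n)))%N
    = column_sequency n j.
Proof.
move=> n_gt1 lt_jn; have n_gt0 : (0 < n)%N by lia.
pose q k := (2 * (k * j) %/ n)%N.
have q0 : q 0%N = 0%N by rewrite /q mul0n muln0 div0n.
have qS k : q k.+1 = ((2 * (k * j) + 2 * j) %/ n)%N by rewrite /q; congr divn; lia.
(* [c] is [ceil (2 * j / n)]; it is subtracted from [2 * j] in [q (n - 1)] *)
have q_last c : (c <= 2 * j)%N -> (2 * j <= c * n)%N -> (c * n < 2 * j + n)%N ->
    q n.-1 = (2 * j - c)%N.
  move=> le_c2j le_2j lt_2j; rewrite /q.
  have -> : (2 * (n.-1 * j) = (2 * j - c) * n + (c * n - 2 * j))%N by nia.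
  by rewrite divnMDl // divn_small ?addn0 //; lia.
rewrite /column_sequency; case: leqP => hj.
  rewrite (@parity_changes_slow q) // => [|k].
    case: (posnP j) => [j0|j_gt0]; first by rewrite (q_last 0%N) //; lia.
    by rewrite (q_last 1%N) //; lia.
  by rewrite qS -{1}[q k]addn0; apply: divn_step; lia.
rewrite (@parity_changes_fast q) // => [|k].
  by rewrite (q_last 2%N) //; lia.
by rewrite qS; apply: divn_step; lia.
Qed.

Theorem theorem2p5 (n m : nat) (hn : (1 < n)%N) (hm : (0 < m)%N)
    (hnm : n = (2 * m)%N \/ n = (2 * m + 1)%N) (A : 'M[sign]_n)
    (hA : forall i j : 'I_n,
       val (A i j) =
         if (n == 2 * m)%N && [exists t : 'I_m, i * j == t %[mod n]] then 1
         else if (n == 2 * m + 1)%N && [exists t : 'I_m.+1, i * j == t %[mod n]]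
         then 1
         else -1) :
  sequency_complete A.
Proof.
have n_gt0 : (0 < n)%N by lia.
exists (fun j : 'I_n => Ordinal (column_sequency_lt n_gt0 (ltn_ord j))).
  apply: injF_bij => i j [/column_sequency_inj eq_ij].
  by apply: val_inj; apply: eq_ij.
move=> j; rewrite /= -wave_parity_changes //.
rewrite (@sequency_of_exponents _ _ (fun i => 2 * (i * j) %/ n)%N) // => i.
by rewrite mxE hA wave_sign.
Qed.
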